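(* Let $n \geq 1$ and let $c$ be a $2$-coloring of $E(Q_n)$ such that every path in $Q_n$ connecting a pair of antipodal vertices changes colors at least $k$ times, where $k > 1$ is an integer. Then the component graph $\mathrm{Comp}(Q_n,c)$ contains an induced cycle of length at least $2k-2$.
   Context: $Q_n$ is the graph with vertex set $\{0,1\}^n$, two vertices adjacent iff they differ in exactly one coordinate; two vertices are antipodal if they differ in every coordinate. A $2$-coloring of $E(Q_n)$ is a function from $E(Q_n)$ to $\{\text{red},\text{blue}\}$. A monochromatic component is a connected component of the spanning subgraph formed by the edges of one color. The component graph $\mathrm{Comp}(Q_n,c)$ has as vertices the monochromatic components, two being adjacent if they share at least one vertex of $Q_n$. A path changes colors $t$ times if exactly $t$ pairs of consecutive edges on it have different colors. *)

(* Defs.v *)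
From mathcomp Require Import all_boot.

Set Implicit Arguments.
Unset Strict Implicit.
Unset Printing Implicit Defensive.

Notation vertex n := {ffun 'I_n -> bool}.

Definition qadj n (x y : vertex n) : bool := #|[set i | x i != y i]| == 1.

Definition antipodal n (x y : vertex n) : bool := [forall i, x i != y i].

(* Edges are unordered pairs, i.e. two-element sets of adjacent vertices. *)
Definition is_edge n (e : {set vertex n}) : bool :=
  [exists x, exists y, qadj x y && (e == [set x; y])].

Notation edge n := {e : {set vertex n} | is_edge e}.

(* The two colors are the booleans: true is red, false is blue. *)
Notation color := bool.
Notation coloring n := (edge n -> color).

(* The color of the edge xy. The default value red is only reached when x and *)
(* y are not adjacent; every use below is guarded by adjacency.               *)
Definition edge_color n (c : coloring n) (x y : vertex n) : color :=
  if insub [set x; y] is Some e then c e else true.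

Lemma edge_colorE n (c : coloring n) (x y : vertex n) (e : edge n) :
  val e = [set x; y] -> edge_color c x y = c e.
Proof. by move=> ve; rewrite /edge_color -ve valK. Qed.

Lemma edge_colorC n (c : coloring n) (x y : vertex n) :
  edge_color c x y = edge_color c y x.
Proof. by rewrite /edge_color setUC. Qed.

Definition seq_changes (s : seq color) : nat :=
  if s is a :: s' then count id (pairmap (fun a b => a != b) a s') else 0.

(* Number of color changes along the path whose vertex sequence is x :: p. *)
Definition color_changes n (c : coloring n) (x : vertex n) (p : seq (vertex n))
    : nat :=
  seq_changes (pairmap (edge_color c) x p).

(* Adjacency in the spanning subgraph formed by the edges of color a. *)
Definition mono_adj n (c : coloring n) (a : color) : rel (vertex n) :=
  fun x y => qadj x y && (edge_color c x y == a).

(* A monochromatic component is encoded as its color together with its vertex *)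
(* set. The color is needed because a red and a blue component may have the   *)
(* same vertex set; as subgraphs they are nevertheless distinct when n >= 1.  *)
(* A vertex incident with no edge of color a is a singleton component of      *)
(* color a, since the one-color subgraphs are spanning.                       *)
Definition is_mono_comp n (c : coloring n) (K : color * {set vertex n}) : bool :=
  [exists x, K.2 == [set y | connect (mono_adj c K.1) x y]].

Notation mono_comp c := {K | is_mono_comp c K}.

Definition comp_graph n (c : coloring n) : rel (mono_comp c) :=
  fun K L => (K != L) && ((val K).2 :&: (val L).2 != set0).

Lemma comp_graph_irr n (c : coloring n) : irreflexive (comp_graph (c := c)).
Proof. by move=> K; rewrite /comp_graph eqxx. Qed.

Lemma comp_graph_sym n (c : coloring n) : symmetric (comp_graph (c := c)).
Proof. by move=> K L; rewrite /comp_graph eq_sym setIC. Qed.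

(* s lists, in cyclic order, the vertices of a chordless cycle of length      *)
(* size s of the simple graph e.                                              *)
Definition induced_cycle (T : eqType) (e : rel T) (s : seq T) : Prop :=
  [/\ 2 < size s, uniq s, cycle e s &
      {in s &, forall x y, e x y -> y = next s x \/ x = next s y}].

(* Main.v *)
(* Every vertex x of the cube lies in one red and one blue component, which   *)
(* are adjacent in the bipartite component graph G. Call a set of components  *)
(* D a region if it is connected in G, and let B be its boundary, the set of  *)
(* neighbours of D outside D. If B is also the boundary of a second connected *)
(* set A, then any two components u, v of B at distance d > 1 in G lie on an  *)
(* induced cycle of length at least 2d, glued from induced paths through A and *)
(* through D. Moreover the union of the components in B is connected in the   *)
(* cube, because the cube is simply connected.                                *)
(*   Suppose now that the antipodes of all vertices covered by B lie inside D,*)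
(* pick s in B and let Om be B together with the neighbours of s in D. If Om  *)
(* covers two antipodal vertices x and x', the components containing them are *)
(* at distance at least k, and moving one of them to s if necessary gives two *)
(* components of B at distance at least k - 1, hence the cycle. Otherwise the *)
(* connected set covered by Om has all its antipodes in a single region that  *)
(* is a proper subset of D, whose boundary is contained in Om and can be      *)
(* joined through s and A: descend.                                           *)

Require Import Defs.
From mathcomp Require Import all_boot.

Set Implicit Arguments.
Unset Strict Implicit.
Unset Printing Implicit Defensive.

(** By [antipodal_comp_dist], components through antipodal vertices are at distance at least [k] in
    the component graph. It suffices to find such a pair, up to a loss of one, on a boundary between
    two separated sides: [separated_induced_cycle] turns distance [m] there into an induced cycle of
    length at least [2 * m], and the loss of one accounts for the 2 in [2 * k - 2]. [descent]
    searches for the pair by shrinking a region that contains the antipodes of everything its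
    boundary covers. While no pair appears, [boundary_connected] (resting on [cube_cocycle]) and
    [star_connected] make the enlarged boundary connected in the cube, so [antipodal_region] finds
    all its antipodes in one region, a proper subset of the old one; finiteness ends the search. In
    degenerate positions [k] is 2 and any induced cycle is long enough; [neighbors_induced_cycle]
    supplies it. *)

Definition restrict (T : finType) (e : rel T) (X : {set T}) : rel T :=
  fun x y => [&& x \in X, y \in X & e x y].

(** * Connectivity inside a subset *)

Section Restrict.
Variables (T : finType) (e : rel T).
Implicit Types X Y : {set T}.

Lemma restrict_sym X : symmetric e -> symmetric (restrict e X).
Proof. by move=> es x y; rewrite /restrict es andbCA. Qed.

Lemma connect1_restrict X x y : x \in X -> y \in X -> e x y ->
  connect (restrict e X) x y.
Proof. by move=> xX yX xy; apply: connect1; apply/and3P. Qed.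

Lemma connect_restrictS X Y : X \subset Y ->
  subrel (connect (restrict e X)) (connect (restrict e Y)).
Proof.
move=> /subsetP XY; apply: connect_sub => x y /and3P[xX yX xy].
by apply: connect1; rewrite /restrict !XY.
Qed.

(** The first alternative is there because [connect] is reflexive also outside [X]. *)
Lemma connect_restrict_in X x y :
  connect (restrict e X) x y -> x = y \/ x \in X /\ y \in X.
Proof.
case/connectP=> p; elim: p x => [|z p IH] x /=; first by left.
case/andP=> /and3P[xX zX _] /IH{}IH /IH[<-|[]]; by right.
Qed.

Lemma connect_invariant (r : rel T) (Q : eqType) (f : T -> Q) x y :
  (forall z t, r z t -> f z = f t) -> connect r x y -> f x = f y.
Proof.
move=> rf /connectP[p]; elim: p x => [|z p IH] x /=; first by move=> _ ->.
by case/andP=> /rf-> /IH{}IH /IH.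
Qed.

End Restrict.

(* An induced path of e, presented as its first vertex and its tail. *)
Fixpoint ipath (T : eqType) (e : rel T) (x : T) (p : seq T) : bool :=
  if p is y :: q then [&& e x y, x \notin p, ~~ has (e x) q & ipath e y q]
  else true.

(** * Induced paths and their gluing *)

Section InducedPaths.
Variables (T : eqType) (e : rel T).
Implicit Types (x y z : T) (p q s : seq T).

Lemma ipath_path x p : ipath e x p -> path e x p.
Proof. by elim: p x => //= y q IH x /and4P[-> _ _ /IH]. Qed.

Lemma ipath_uniq x p : ipath e x p -> uniq (x :: p).
Proof. by elim: p x => //= y q IH x /and4P[_ -> _ /IH]. Qed.

Lemma ipath_suffix x p y : ipath e x p -> y \in x :: p ->
  exists q, [/\ ipath e y q, last y q = last x p & {subset y :: q <= x :: p}].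
Proof.
elim: p x => [|z p IH] x /=.
  by move=> _; rewrite inE => /eqP->; exists [::]; split.
move=> xzp; rewrite inE => /predU1P[->|]; first by exists (z :: p); split.
case/and4P: xzp => _ _ _ /IH/[apply] -[q [qP ql qs]].
by exists q; split=> // t /qs; rewrite (in_cons x) => ->; rewrite orbT.
Qed.

(** Jump from [x] to its last neighbour on the path: beyond that point [x] has no chord. *)
Lemma ipath_extend x y p : ipath e y p -> x \notin y :: p -> has (e x) (y :: p) ->
  exists q, [/\ ipath e x q, last x q = last y p & {subset q <= y :: p}].
Proof.
elim: p y => [|z p IH] y.
  by move=> _ xy; rewrite /= orbF => exy; exists [:: y]; split=> //=; rewrite exy xy.
move=> yzp xN; case: (boolP (has (e x) (z :: p))) => [hxz _|hxz].
  have xzp : x \notin z :: p by move: xN; rewrite inE negb_or => /andP[].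
  case/and4P: (yzp) => _ _ _ zp.
  have [q [qP ql qs]] := IH z zp xzp hxz.
  by exists q; split=> // t /qs; rewrite (in_cons y) => ->; rewrite orbT.
rewrite [has _ _]/= -/(has (e x) (z :: p)) (negbTE hxz) orbF => exy.
by exists [:: y, z & p]; split=> //; apply/and4P; split.
Qed.

(** Built from the far end: if [x] already lies on the induced path made from the tail, cut there;
    otherwise prepend [x] by [ipath_extend]. *)
Lemma path_ipath x p : path e x p ->
  exists q, [/\ ipath e x q, last x q = last x p & {subset q <= x :: p}].
Proof.
elim: p x => [|y p IH] x /=; first by exists [::]; split.
case/andP=> exy /IH[q [qP ql qs]].
have sub z : z \in y :: q -> z \in [:: x, y & p].
  rewrite inE => /predU1P[->|/qs zyp]; first by rewrite !inE eqxx orbT.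
  by rewrite (in_cons x) zyp orbT.
case: (boolP (x \in y :: q)) => [xq|xq].
  have [q' [q'P q'l q's]] := ipath_suffix qP xq.
  exists q'; split=> //; first by rewrite q'l ql.
  by move=> z zq'; apply/sub/q's; rewrite inE zq' orbT.
have [|q' [q'P q'l q's]] := ipath_extend qP xq; first by rewrite /= exy.
exists q'; split=> //; first by rewrite q'l ql.
by move=> z /q's /sub.
Qed.

Definition consecutive s x y := exists s1 s2, s = s1 ++ [:: x, y & s2].

Lemma consecutive_catr s s' x y : consecutive s x y -> consecutive (s ++ s') x y.
Proof. by case=> s1 [s2 ->]; exists s1, (s2 ++ s'); rewrite -catA. Qed.

Lemma consecutive_next s x y : uniq s -> consecutive s x y -> y = next s x.
Proof.
move=> us [s1 [s2 sE]].
rewrite -(next_rot (size s1)) // sE rot_size_cat /= eqxx //.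
Qed.

Lemma ipath_consecutive x p y z : irreflexive e -> symmetric e ->
  ipath e x p -> y \in x :: p -> z \in x :: p -> e y z ->
  consecutive (x :: p) y z \/ consecutive (x :: p) z y.
Proof.
move=> ei es; elim: p x => [|t p IH] x.
  by rewrite !inE => _ /eqP-> /eqP->; rewrite ei.
case/and4P=> ext _ /hasPn nex /IH{}IH.
have main u : u \in t :: p -> e x u -> consecutive [:: x, t & p] x u.
  rewrite inE => /predU1P[->|/nex/negP//] _; by exists [::], p.
have cons u v : consecutive (t :: p) u v -> consecutive [:: x, t & p] u v.
  by case=> s1 [s2 ->]; exists (x :: s1), s2.
rewrite (in_cons x _ y) (in_cons x _ z) => /predU1P[->|yp] /predU1P[->|zp] eyz.
- by rewrite ei in eyz.
- by left; apply: main.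
- by right; apply: main => //; rewrite es.
- by case: (IH yp zp eyz) => /cons; [left | right].
Qed.

(** No edge joins the two interiors, so every edge between vertices of the cycle has both ends on
    one of the two induced paths and is one of its steps. *)
Lemma glue_induced_cycle u v p q : irreflexive e -> symmetric e ->
  ipath e u (rcons p v) -> ipath e v (rcons q u) ->
  0 < size p -> 0 < size q ->
  (forall x y, x \in p -> y \in q -> x != y /\ ~~ e x y) ->
  induced_cycle e (u :: p ++ v :: q).
Proof.
move=> ei es up vq p0 q0 pq.
have /= := ipath_uniq up; rewrite mem_rcons inE rcons_uniq negb_or.
case/and3P=> /andP[uv uNp] vNp uqp.
have /= := ipath_uniq vq; rewrite mem_rcons inE rcons_uniq negb_or.
case/and3P=> /andP[_ vNq] uNq uqq.
have uq : uniq (u :: p ++ v :: q).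
  rewrite cons_uniq mem_cat inE !negb_or uNp uv uNq cat_uniq uqp cons_uniq vNq uqq.
  rewrite !andbT; apply/hasPn => x; rewrite inE => /predU1P[->//|xq].
  by apply/negP => /pq/(_ xq)[/eqP].
(* [next] is invariant under rotation; starting at [v] makes the second path contiguous. *)
have rotE : rot (size (u :: p)) (u :: p ++ v :: q) = v :: q ++ u :: p.
  by rewrite -cat_cons rot_size_cat.
split=> //.
- by rewrite /= size_cat /= addnS; case: (size p) p0 => // m; case: (size q) q0.
- rewrite /= rcons_cat cat_path rcons_cons /=.
  have := ipath_path up; have := ipath_path vq.
  by rewrite rcons_path => /andP[-> ->] /=; rewrite rcons_path => /andP[-> ->].
have cs x y : consecutive (u :: rcons p v) x y -> y = next (u :: p ++ v :: q) x.
  move=> c; apply: consecutive_next => //.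
  by rewrite -cat_rcons -cat_cons; apply: consecutive_catr.
have cs' x y : consecutive (v :: rcons q u) x y -> y = next (u :: p ++ v :: q) x.
  move=> c; rewrite -(next_rot (size (u :: p))) // rotE.
  apply: consecutive_next; first by rewrite -rotE rot_uniq.
  by rewrite -cat_rcons -cat_cons; apply: consecutive_catr.
have cp x y : x \in u :: rcons p v -> y \in u :: rcons p v -> e x y ->
    y = next (u :: p ++ v :: q) x \/ x = next (u :: p ++ v :: q) y.
  by move=> xp yp /(ipath_consecutive ei es up xp yp)[] /cs; [left|right].
have cq x y : x \in v :: rcons q u -> y \in v :: rcons q u -> e x y ->
    y = next (u :: p ++ v :: q) x \/ x = next (u :: p ++ v :: q) y.
  by move=> xp yp /(ipath_consecutive ei es vq xp yp)[] /cs'; [left|right].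
have mem x : x \in u :: p ++ v :: q -> 
    (x \in p) || (x \in q) || (x \in [:: u; v]).
  by rewrite !inE mem_cat inE; case: (x == u); case: (x == v); case: (x \in p);
    case: (x \in q).
have inp x : (x \in p) || (x \in [:: u; v]) -> x \in u :: rcons p v.
  by rewrite !inE mem_rcons inE orbC -orbA.
have inq x : (x \in q) || (x \in [:: u; v]) -> x \in v :: rcons q u.
  by rewrite !inE mem_rcons inE orbC -orbA orbCA.
(* Nine positions of the two ends; only the two with one end in each interior are not covered by a
   single path. *)
move=> x y /mem /orP[/orP[]|] xs /mem /orP[/orP[]|] ys exy.
all: try by apply: cp => //; apply: inp; rewrite ?xs ?ys ?orbT.
all: try by apply: cq => //; apply: inq; rewrite ?xs ?ys ?orbT.
- by have [_ /negP] := pq _ _ xs ys.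
- by have [_ /negP] := pq _ _ ys xs; rewrite es.
Qed.

End InducedPaths.

Lemma ipath_catl (T : eqType) (e : rel T) x p q :
  ipath e x (p ++ q) -> ipath e x p.
Proof.
elim: p x => //= y p IH x; rewrite has_cat !in_cons mem_cat !negb_or.
by case/and4P=> -> /and3P[-> -> _] /andP[-> _] /IH.
Qed.

(** * Induced cycles through separated sets *)

Section Separation.
Variables (T : finType) (e : rel T).
Hypotheses (e_irr : irreflexive e) (e_sym : symmetric e).
Implicit Types A D X : {set T}.

Lemma restrict_path X x p : path (restrict e X) x p ->
  path e x p /\ {subset p <= X}.
Proof.
elim: p x => // y p IH x /andP[/and3P[_ yX xy] /IH[yp pX]].
by split=> [|z]; [rewrite /= xy | rewrite inE => /predU1P[->|/pX]].
Qed.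

Lemma connect_ipath X x y : connect (restrict e X) x y -> x != y ->
  exists q, ipath e x (rcons q y) /\ {subset rcons q y <= X}.
Proof.
case/connectP=> p rp yE xy; have [xp pX] := restrict_path rp.
have xX : x \in X.
  by case: p rp yE {xp pX} => [_ yx|z p /= /andP[/and3P[]]//]; rewrite yx eqxx in xy.
have [q [xq qy qX]] := path_ipath xp.
have {}qX : {subset q <= X}.
  by move=> z /qX; rewrite inE => /predU1P[->|/pX].
case/lastP: q xq qy qX => [_ /= xy'|q z xq]; first by rewrite xy' -yE eqxx in xy.
by rewrite last_rcons -yE => zy qX; exists q; rewrite -{1}zy -zy.
Qed.

Lemma connect_interior_ipath D u v :
  connect (restrict e (u |: (v |: D))) u v -> u != v ->
  exists q, ipath e u (rcons q v) /\ {subset q <= D}.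
Proof.
move=> cuv uv; have [q [uq qX]] := connect_ipath cuv uv; exists q; split=> // z zq.
have /= := ipath_uniq uq; rewrite mem_rcons inE rcons_uniq negb_or.
case/and3P=> /andP[_ uNq] vNq _.
have /qX : z \in rcons q v by rewrite mem_rcons inE zq orbT.
rewrite !inE => /or3P[/eqP zu|/eqP zv|//].
  by rewrite -zu zq in uNq.
by rewrite -zv zq in vNq.
Qed.

(** An induced path from [u] to [v] through either side has at least [m - 1] interior vertices, and
    the two ends bring the total to [2 * m]. Since [m > 1], the ends are distinct and not adjacent,
    so neither interior is empty. *)
Lemma separated_induced_cycle A D u v m : 1 < m ->
  (forall p, path e u p -> last u p = v -> m <= size p) ->
  connect (restrict e (u |: (v |: D))) u v ->
  connect (restrict e (u |: (v |: A))) u v ->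
  (forall x y, x \in D -> y \in A -> x != y /\ ~~ e x y) ->
  exists s, induced_cycle e s /\ 2 * m <= size s.
Proof.
move=> m1 far cD cA DA.
have uv : u != v by apply/eqP => uv; have := far [::] isT uv; case: m m1 {far}.
have euv : ~~ e u v.
  apply/negP => euv; have := far [:: v]; rewrite /= euv => /(_ isT erefl).
  by rewrite leqNgt m1.
have [p [up pD]] := connect_interior_ipath cD uv.
have [q [vq qA]] : exists q, ipath e v (rcons q u) /\ {subset q <= A}.
  apply: connect_interior_ipath; last by rewrite eq_sym.
  by rewrite setUCA (sym_connect_sym (restrict_sym _ e_sym)).
have szp : m <= (size p).+1.
  by rewrite -(size_rcons p v); apply: far; [apply: ipath_path | rewrite last_rcons].
(* This path runs from [v] to [u], so it is reversed before the distance bound applies. *)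
have szq : m <= (size q).+1.
  rewrite -(size_rcons q u) -(size_belast v) -size_rev; apply: far; last first.
    by rewrite belast_rcons rev_cons last_rcons.
  rewrite -{1}(last_rcons v q u) rev_path.
  by rewrite (eq_path (e' := e)) ?ipath_path // => x y; rewrite e_sym.
exists (u :: p ++ v :: q); split; last first.
  by rewrite /= size_cat /= addnS -addSn -addnS mul2n -addnn leq_add.
apply: glue_induced_cycle => //.
- by case: p up {pD szp}; rewrite //= (negbTE euv).
- by case: q vq {qA szq}; rewrite //= e_sym (negbTE euv).
- by move=> x y /pD xD /qA yA; apply: DA.
Qed.

(** Follow an induced path in [X] from [a] to the next neighbour [z] of [s] and close it through
    [s]. As [a] and [z] are both neighbours of [s], they are not adjacent, so the path has an
    interior. *)
Lemma neighbors_induced_cycle X s a b :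
  (forall x y, e s x -> e s y -> ~~ e x y) ->
  s \notin X -> e s a -> e s b -> a != b -> connect (restrict e X) a b ->
  exists t, induced_cycle e t.
Proof.
move=> tri sX sa sb ab /connect_ipath/(_ ab)[q [aq qX]].
have sq : has (e s) (rcons q b) by rewrite has_rcons sb.
case/split_find: sq aq qX => z p1 p2 sz p1N /ipath_catl ap1 p1X.
have sNp1 : s \notin p1.
  by apply: contra sX => sp1; apply: p1X; rewrite mem_cat mem_rcons inE sp1 orbT.
have := ipath_uniq ap1; rewrite /= mem_rcons inE negb_or => /andP[/andP[az _] _].
have as_ : s != a by apply/eqP => sa'; rewrite sa' e_irr in sa.
have zs : z != s by apply/eqP => sz'; rewrite sz' e_irr in sz.
exists (a :: p1 ++ [:: z; s]); apply: glue_induced_cycle => //.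
- rewrite /= !inE negb_or orbF andbT [e z s]e_sym sz zs eq_sym az tri //=.
  by rewrite sa as_.
- by case: p1 ap1 {p1N p1X sNp1} => //=; rewrite (negbTE (tri _ _ sa sz)).
- move=> x y xp1; rewrite inE => /eqP->; split.
    by apply: contraNneq sNp1 => <-.
  by rewrite e_sym; apply: (hasPn p1N).
Qed.

End Separation.

(** * The hypercube and its cocycles *)

Definition flip n (i : 'I_n) (x : vertex n) : vertex n :=
  [ffun j => x j (+) (j == i)].

Definition antipode n (x : vertex n) : vertex n := [ffun i => ~~ x i].

Section Cube.
Variable n : nat.
Implicit Types (x y : vertex n) (i j : 'I_n).

Lemma flipK i : involutive (@flip n i).
Proof. by move=> x; apply/ffunP => j; rewrite !ffunE -addbA addbb addbF. Qed.

Lemma flipC i j x : flip i (flip j x) = flip j (flip i x).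
Proof. by apply/ffunP => l; rewrite !ffunE addbAC. Qed.

Lemma antipodeK : involutive (@antipode n).
Proof. by move=> x; apply/ffunP => i; rewrite !ffunE negbK. Qed.

Lemma antipodalP x : antipodal x (antipode x).
Proof. by apply/forallP => i; rewrite ffunE; case: (x i). Qed.

Lemma qadj_sym : symmetric (@qadj n).
Proof.
by move=> x y; rewrite /qadj; congr (#|pred_of_set _| == 1); apply/setP => i;
  rewrite !inE eq_sym.
Qed.

Lemma qadj_antipode x y : qadj (antipode x) (antipode y) = qadj x y.
Proof.
rewrite /qadj; congr (#|pred_of_set _| == 1); apply/setP => i.
by rewrite !inE !ffunE; case: (x i); case: (y i).
Qed.

Lemma qadjP x y : reflect (exists i, y = flip i x) (qadj x y).
Proof.
apply: (iffP cards1P) => -[i xy]; exists i.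
  apply/ffunP => j; rewrite !ffunE; move/setP/(_ j): xy.
  by rewrite !inE; case: (x j); case: (y j) => <-.
by apply/setP => j; rewrite !inE xy ffunE; case: (x j); case: (j == i).
Qed.

Lemma connect_qadj x y : connect (@qadj n) x y.
Proof.
have [m] := ubnP #|[set i | x i != y i]|; elim: m x => // m IH x le_m.
have [/eqP|[i]] := set_0Vmem [set i | x i != y i].
  rewrite -subset0 => /subsetP eq_xy; have -> : x = y; last exact: connect0.
  by apply/ffunP => i; apply/eqP; have := eq_xy i; rewrite !inE; case: (_ == _) => // ->.
rewrite inE => xyi; apply: (@connect_trans _ _ (flip i x)).
  by apply/connect1/qadjP; exists i.
apply: IH; rewrite -ltnS; apply: leq_trans le_m; rewrite ltnS; apply: proper_card.
apply/properP; split; last first.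
  by exists i; rewrite !inE // ffunE eqxx; move: xyi; case: (x i); case: (y i).
apply/subsetP => j; rewrite !inE ffunE; case: (j =P i) => [-> _ //|_].
by rewrite addbF.
Qed.

(* H^1(Q_n; Z/2) = 0. *)
Lemma cube_cocycle (h : 'I_n -> vertex n -> bool) :
  (forall i x, h i (flip i x) = h i x) ->
  (forall i j x, h i x (+) h j (flip i x) = h j x (+) h i (flip j x)) ->
  exists g : vertex n -> bool, forall i x, h i x = g x (+) g (flip i x).
Proof.
move=> hsym hsq.
suff main m : exists g : vertex n -> bool,
    forall i x, i < m -> h i x = g x (+) g (flip i x).
  by have [g gP] := main n; exists g => i x; apply: gP.
elim: m => [|m [g gP]]; first by exists xpred0.
case: (ltnP m n) => [mn|nm]; last first.
  by exists g => i x _; apply: gP; apply: leq_trans (ltn_ord i) nm.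
(* [h'] is the error of [g] in the new direction [k]. The square condition makes it invariant under
   flips in the earlier directions. *)
pose k := Ordinal mn; pose h' x := h k x (+) (g x (+) g (flip k x)).
have h'k x : h' (flip k x) = h' x.
  by rewrite /h' hsym flipK (addbC (g _)).
have h'i i x : i < m -> h' (flip i x) = h' x.
  move=> im; rewrite /h' (flipC k).
  have := hsq i k x; rewrite (gP i) // (gP i) //.
  by do 4!case: (g _); case: (h k x); case: (h k _).
(* Adding the error on the half-cube where coordinate [k] is true repairs direction [k] and leaves
   the earlier directions unchanged. *)
exists (fun x => g x (+) (x k && h' x)) => i x; rewrite ltnS leq_eqVlt.
case/predU1P=> [ik|im].
  have {ik}-> : i = k by apply: val_inj.
  rewrite h'k !ffunE eqxx /h'.
  by case: (x k); case: (g _); case: (g _); case: (h k x).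
rewrite (h'i i) // !ffunE (_ : (k == i) = false); last first.
  by apply/negbTE; rewrite -val_eqE /= gtn_eqF.
by rewrite addbF (gP i) //; case: (_ && _); case: (g _); case: (g _).
Qed.

End Cube.

(** * Color changes and distances between components *)

Lemma seq_changes_consr a b s :
  seq_changes (a :: s) <= seq_changes [:: a, b & s].
Proof. by case: s => [|d s] //=; rewrite addnA leq_add2r; case: a; case: b; case: d. Qed.

Lemma seq_changes_suffix a s1 s2 :
  seq_changes (a :: s2) <= seq_changes (a :: s1 ++ s2).
Proof.
elim: s1 => //= b s1 IH; apply: leq_trans IH _; exact: seq_changes_consr.
Qed.

Lemma seq_changes_nseq a m s :
  seq_changes (a :: nseq m a ++ s) = seq_changes (a :: s).
Proof. by elim: m => //= m IH; rewrite eqxx. Qed.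

Section Components.
Variables (n : nat) (c : coloring n).
Implicit Types (x y z : vertex n) (a b : color) (K L : mono_comp c).
Implicit Types (X : {set mono_comp c}).

Fact comp_subproof a x :
  is_mono_comp c (a, [set y | connect (mono_adj c a) x y]).
Proof. by apply/existsP; exists x. Qed.

Definition comp a x : mono_comp c := Sub (_, _) (comp_subproof a x).

Lemma mono_adj_sym a : symmetric (mono_adj c a).
Proof. by move=> x y; rewrite /mono_adj qadj_sym edge_colorC. Qed.

Lemma eq_comp a x y : (comp a x == comp a y) = connect (mono_adj c a) x y.
Proof.
have cs := sym_connect_sym (mono_adj_sym a).
apply/eqP/idP=> [[/setP/(_ y)]|xy]; first by rewrite !inE connect0.
apply: val_inj; congr pair; apply/setP => z; rewrite !inE.
exact: same_connect.
Qed.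

Lemma comp_color_inj a b x y : comp a x = comp b y -> a = b.
Proof. by case. Qed.

Lemma comp_of_mem K x : x \in (val K).2 -> K = comp (val K).1 x.
Proof.
case: K => -[a A] /= KP; have /existsP[y /eqP /= AE] := KP => xA.
apply: val_inj => /=; move: xA; rewrite AE inE => xy.
have := xy; rewrite -eq_comp => /eqP[->//].
Qed.

Lemma mono_compP K : exists a x, K = comp a x.
Proof.
have /existsP[x /eqP KE] := valP K; exists (val K).1, x.
by apply: comp_of_mem; rewrite KE inE.
Qed.

(** Components of one color partition the vertices, so two distinct components that meet have
    opposite colors. *)
Lemma comp_graphP K L :
  reflect (exists a x, K = comp a x /\ L = comp (~~ a) x) (comp_graph K L).
Proof.
apply: (iffP andP) => [[KL /set0Pn[x /setIP[xK xL]]]|[a [x [-> ->]]]].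
  exists (val K).1, x; split; first exact: comp_of_mem.
  rewrite {1}(comp_of_mem xL); congr comp; move: KL.
  rewrite (comp_of_mem xK) {1}(comp_of_mem xL) /=.
  by case: (val K).1; case: (val L).1 => //; rewrite eqxx.
split; first by apply/eqP => /comp_color_inj; case: a.
by apply/set0Pn; exists x; rewrite !inE /= !connect0.
Qed.

Lemma comp_graph_triangle_free K L M :
  comp_graph K L -> comp_graph K M -> ~~ comp_graph L M.
Proof.
move=> /comp_graphP[a [x [-> ->]]] /comp_graphP[b [y [/comp_color_inj<- ->]]].
by apply/comp_graphP => -[d [z [/comp_color_inj<- /comp_color_inj]]]; case: a.
Qed.

Lemma comp_graph_negb a x : comp_graph (comp a x) (comp (~~ a) x).
Proof. by apply/comp_graphP; exists a, x. Qed.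

Lemma qadj_comp x y : qadj x y ->
  exists a, comp a x = comp a y.
Proof.
move=> xy; exists (edge_color c x y); apply/eqP; rewrite eq_comp.
by apply: connect1; rewrite /mono_adj xy eqxx.
Qed.

Definition touched X : {set vertex n} := [set x | [exists a, comp a x \in X]].

Lemma touchedP X x : reflect (exists a, comp a x \in X) (x \in touched X).
Proof. by rewrite inE; apply: existsP. Qed.

Lemma connect_in_comp X a x y : comp a x = comp a y -> comp a x \in X ->
  connect (restrict (@qadj n) (touched X)) x y.
Proof.
move=> /eqP; rewrite eq_comp => /connectP[p]; elim: p x => [|z p IH] x /=.
  by move=> _ ->.
case/andP=> xz zp yE xX; have xzE : comp a x = comp a z.
  by apply/eqP; rewrite eq_comp connect1.
have zX : comp a z \in X by rewrite -xzE.
apply: connect_trans (IH z zp yE zX); apply: connect1.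
by case/andP: xz => xz _; apply/and3P; split=> //; apply/touchedP; exists a.
Qed.

(** Successive components share a vertex, and each is connected in the cube. *)
Lemma connect_touched X a b x y :
  connect (restrict (@comp_graph n c) X) (comp a x) (comp b y) ->
  comp a x \in X -> connect (restrict (@qadj n) (touched X)) x y.
Proof.
case/connectP=> p; elim: p a x => [|K p IH] a x /=.
  move=> _ xy xX; have ab := comp_color_inj xy; rewrite ab in xy xX *.
  exact: connect_in_comp xX.
case/andP=> /and3P[_ KX /comp_graphP[d [z [xz KE]]]].
have ad := comp_color_inj xz; rewrite {}KE in KX *; rewrite {}ad in xz *.
move=> zp yE xX; apply: connect_trans (connect_in_comp xz xX) _.
exact: IH zp yE KX.
Qed.

Lemma connect_mono_walk a x y : connect (mono_adj c a) x y ->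
  exists q, [/\ path (@qadj n) x q, last x q = y &
                pairmap (edge_color c) x q = nseq (size q) a].
Proof.
case/connectP=> p xp ->; exists p; split=> //.
  by apply: sub_path xp => z t /andP[].
by elim: p x xp => //= z p IH x /andP[/andP[_ /eqP->] /IH->].
Qed.

(** Walk inside each component to a vertex shared with the next one: the color can change only when
    passing between components. The prefixed color [a] records the component in which the walk
    starts, even if no edge of it is used. *)
Lemma comp_graph_walk a b x y p :
  path (@comp_graph n c) (comp a x) p -> last (comp a x) p = comp b y ->
  exists q, [/\ path (@qadj n) x q, last x q = y &
                seq_changes (a :: pairmap (edge_color c) x q) <= size p].
Proof.
elim: p a x => [|K p IH] a x /=.
  move=> _ xy; have ab := comp_color_inj xy; rewrite -ab in xy.
  have [|q [xq qy qE]] := @connect_mono_walk a x y; first by rewrite -eq_comp xy.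
  exists q; split=> //; rewrite qE -[nseq _ _]cats0.
  by have := seq_changes_nseq a (size q) [::] => /= ->.
case/andP=> /comp_graphP[d [z [xz ->]]].
have ad := comp_color_inj xz; rewrite -{d}ad in xz * => zp /(IH _ _ zp).
case=> q [zq qy qE].
have [|q' [xq' q'z q'E]] := @connect_mono_walk a x z; first by rewrite -eq_comp xz.
exists (q' ++ q); rewrite cat_path last_cat pairmap_cat q'z q'E.
split=> //; first by rewrite xq'.
rewrite -[count _ _]/(seq_changes (a :: _)) seq_changes_nseq; move: qE.
case: (pairmap _ _ _) => //= d s.
rewrite -ltnS; apply: leq_trans; rewrite -addSn leq_add2r.
by case: (a != d).
Qed.

(** Cutting out closed detours deletes a block of colors, which cannot create changes. The bound
    holds for every preceding color [a] so that it passes through the induction. *)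
Lemma walk_to_path x q : path (@qadj n) x q ->
  exists p, [/\ path (@qadj n) x p, uniq (x :: p), last x p = last x q &
    forall a, seq_changes (a :: pairmap (edge_color c) x p)
              <= seq_changes (a :: pairmap (edge_color c) x q)].
Proof.
elim: q x => [|y q IH] x; first by exists [::]; split.
case/andP=> xy /IH[p [yp up pl pc]].
have mono a : seq_changes (a :: pairmap (edge_color c) x (y :: p))
              <= seq_changes (a :: pairmap (edge_color c) x (y :: q)).
  by rewrite /= leq_add2l; apply: pc.
have [xp|xp] := boolP (x \in y :: p); last first.
  by exists (y :: p); split; rewrite // ?cons_uniq ?xp // /= xy.
have [p1 [p2 pE]] : exists p1 p2, y :: p = rcons p1 x ++ p2.
  by case/splitPr: xp => p1 p2; exists p1, p2; rewrite cat_rcons.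
have xyp : path (@qadj n) x (y :: p) by rewrite /= xy.
exists p2; move: xyp up pl mono.
rewrite -[last y p]/(last x (y :: p)) -[last x (y :: q)]/(last y q) pE.
rewrite cat_path last_cat pairmap_cat !last_rcons cat_rcons.
move=> /andP[_ xp2]; rewrite cat_uniq => /and3P[_ _ up2] pl mono; split=> // a.
apply: leq_trans (mono a); apply: seq_changes_suffix.
Qed.

(** Translates the assumption on the coloring into a distance bound in the component graph, the form
    in which the descent uses it. *)
Lemma antipodal_comp_dist k :
  (forall x (p : seq (vertex n)),
     path (@qadj n) x p -> uniq (x :: p) -> antipodal x (last x p) ->
     k <= color_changes c x p) ->
  forall a b x p, path (@comp_graph n c) (comp a x) p ->
    last (comp a x) p = comp b (antipode x) -> k <= size p.
Proof.
move=> far a b x p xp pE; have [q [xq qE qc]] := comp_graph_walk xp pE.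
have [r [xr ur rE rc]] := walk_to_path xq.
have := far x r xr ur; rewrite rE qE => /(_ (antipodalP x)) /leq_trans; apply.
apply: leq_trans qc; apply: leq_trans (rc a); rewrite /color_changes.
by case: (pairmap _ _ _) => //= b' s; apply: leq_addl.
Qed.

Lemma connect_comp_graph K L : connect (@comp_graph n c) K L.
Proof.
have [a [x ->]] := mono_compP K; have [b [y ->]] := mono_compP L.
have same d d' z : connect (@comp_graph n c) (comp d z) (comp d' z).
  have [->|dd'] := eqVneq d d'; first exact: connect0.
  by apply: connect1; have := comp_graph_negb d z; case: d dd'; case: d'.
have /connectP[p xp ->] := connect_qadj x y.
elim: p a x xp => [|z p IH] a x /=; first by move=> _.
case/andP=> /qadj_comp[d xz] zp; apply: connect_trans (same a d x) _.
by rewrite xz; apply: IH.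
Qed.

End Components.

(** * Connectedness of a boundary *)

Section Boundary.
Variables (n : nat) (c : coloring n).
Implicit Types (x y z : vertex n) (a b : color) (K L u v : mono_comp c).
Implicit Types (A D X : {set mono_comp c}).
Local Notation G := (@comp_graph n c).

Definition boundary D := [set K | (K \notin D) && [exists L in D, G K L]].

Lemma boundaryP D K :
  reflect (K \notin D /\ exists2 L, L \in D & G K L) (K \in boundary D).
Proof.
rewrite inE; apply: (iffP andP) => -[KD].
  by case/exists_inP=> L; split; last exists L.
by case=> L LD KL; split=> //; apply/exists_inP; exists L.
Qed.

Lemma adj_boundary D K L : K \in D -> G K L -> L \notin D -> L \in boundary D.
Proof.
by move=> KD KL LD; apply/boundaryP; split=> //; exists K; rewrite // comp_graph_sym.
Qed.

Lemma touchedS X X' : X \subset X' -> touched X \subset touched X'.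
Proof.
move=> /subsetP XY; apply/subsetP => x /touchedP[a /XY aY].
by apply/touchedP; exists a.
Qed.

(* In boundary_connected, s marks the vertices covered by the boundary; there *)
(* t marks a connected component P of them, elsewhere it marks the vertices W *)
(* inside D. Then f marks the edges between P and W, and the claim is that f  *)
(* is a cocycle.                                                              *)
Lemma square_parity (s0 t0 s1 t1 s2 t2 s3 t3 : bool) :
  let f s t s' t' := [&& t, t' & s (+) s'] in
  (s0 == s1) ==> (t0 == t1) -> (s1 == s2) ==> (t1 == t2) ->
  (s2 == s3) ==> (t2 == t3) -> (s3 == s0) ==> (t3 == t0) ->
  [&& s0, ~~ s1 & ~~ s3] ==> (t1 == t3) -> [&& s1, ~~ s0 & ~~ s2] ==> (t0 == t2) ->
  [&& s2, ~~ s1 & ~~ s3] ==> (t1 == t3) -> [&& s3, ~~ s0 & ~~ s2] ==> (t0 == t2) ->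
  f s0 t0 s1 t1 (+) f s1 t1 s2 t2 = f s0 t0 s3 t3 (+) f s3 t3 s2 t2.
Proof.
by case: s0; case: t0; case: s1; case: t1; case: s2; case: t2; case: s3; case: t3.
Qed.

(** A form of unicoherence of the cube. If the covered set had a part [P] containing [x0] but not
    [y0], a closed walk from [x0] to [y0] through [D] and back through [A] would cross between [P]
    and the inside of [D] an odd number of times; these crossings form a cocycle, hence a
    coboundary, which every closed walk meets evenly. *)
Lemma boundary_connected A D :
  [disjoint A & D] ->
  {in boundary D &, forall u v, connect (restrict G (u |: (v |: D))) u v} ->
  {in boundary D &, forall u v, connect (restrict G (u |: (v |: A))) u v} ->
  {in touched (boundary D) &, forall x y,
    connect (restrict (@qadj n) (touched (boundary D))) x y}.
Proof.
move=> AD cD cA x0 y0 x0B y0B; set B := boundary D in cD cA x0B y0B *.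
pose s x := x \in touched B.
pose p := connect (restrict (@qadj n) (touched B)) x0.
pose w x := [forall a, comp c a x \in D].
pose t x := if s x then p x else w x.
pose f x y := [&& t x, t y & s x (+) s y].
(* The two components of a vertex are adjacent, so off the boundary they lie on the same side of
   [D]. *)
have wE x a : ~~ s x -> w x = (comp c a x \in D).
  move=> sx; apply/forallP/idP=> [//|aD b].
  have [<-//|ab] := eqVneq a b; apply: contraR sx => bD; apply/touchedP; exists b.
  by apply: adj_boundary aD _ bD; have := comp_graph_negb c a x; case: a b ab => -[].
have edge x y : qadj x y -> (s x == s y) ==> (t x == t y).
  move=> xy; apply/implyP => /eqP sxy; rewrite /t -sxy.
  case: (boolP (s x)) => sx; apply/eqP.
    have cs := sym_connect_sym (restrict_sym (touched B) (@qadj_sym n)).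
    have xy1 : connect (restrict (@qadj n) (touched B)) x y.
      by apply: connect1; apply/and3P; split; rewrite -/(s _) -?sxy.
    by rewrite /p !(cs x0); apply: same_connect.
  have [a xya] := qadj_comp c xy.
  by rewrite (wE _ a) // (wE _ a) -?sxy // xya.
(* One component of [x] is in the boundary, so the edges to the uncovered [y] and [z] both have the
   other color, and [y] and [z] lie in the same component. *)
have corner x y z : qadj x y -> qadj x z ->
    [&& s x, ~~ s y & ~~ s z] ==> (t y == t z).
  move=> xy xz; apply/implyP => /and3P[sx sy sz].
  have [a xya] := qadj_comp c xy; have [b xzb] := qadj_comp c xz.
  have aB : comp c a x \notin B.
    by apply: contra sy; rewrite xya => aB; apply/touchedP; exists a.
  have bB : comp c b x \notin B.
    by apply: contra sz; rewrite xzb => bB; apply/touchedP; exists b.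
  have ab : a = b.
    have /touchedP[d dB] := sx; apply/eqP; apply: contraTT dB.
    by case: a b d aB bB {xya xzb} => -[] [].
  by rewrite /t (negbTE sy) (negbTE sz) (wE y a) // (wE z a) // -xya -?xzb ab ?xzb.
have qf i x : qadj x (flip i x) by apply/qadjP; exists i.
have fC x y : f x y = f y x by rewrite /f andbCA addbC.
have [||g gP] := @cube_cocycle n (fun i x => f x (flip i x)).
- by move=> i x; rewrite flipK fC.
- move=> i j x; rewrite -(flipC i j); set x2 := flip i (flip j x).
  have q2 : qadj (flip i x) x2 by rewrite /x2 flipC; apply: qf.
  have q3 : qadj (flip j x) x2 by apply: qf.
  have q0 := qf i x; have q1 := qf j x.
  have [q0' q1' q2' q3'] : [/\ qadj (flip i x) x, qadj (flip j x) x,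
    qadj x2 (flip i x) & qadj x2 (flip j x)] by rewrite !(qadj_sym _ x) !(qadj_sym x2).
  exact: square_parity (edge _ _ q0) (edge _ _ q2) (edge _ _ q3') (edge _ _ q1')
    (corner _ _ _ q0 q1) (corner _ _ _ q0' q2) (corner _ _ _ q2' q3')
    (corner _ _ _ q1' q3).
have {}gP x y : qadj x y -> f x y = g x (+) g y.
  by case/qadjP=> i ->; apply: gP.
(* If y0 were not in P, then g x0 = g y0 by a walk through A, which avoids W, *)
(* but g x0 != g y0 by a walk through D, which leaves P only along edges      *)
(* marked by f.                                                               *)
apply/negPn/negP => y0p.
have /touchedP[a aB] := x0B; have /touchedP[b bB] := y0B.
have notD u : u \in B -> u \notin D by case/boundaryP.
have eqA : g x0 = g y0.
  have := connect_touched (cA _ _ aB bB) (setU11 _ _).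
  apply: connect_invariant => x y /and3P[/touchedP[d xd] /touchedP[d' yd] xy].
  have nw z d'' : comp c d'' z \in comp c a x0 |: (comp c b y0 |: A) -> ~~ w z.
    move=> zX; apply/forallP => /(_ d''); move: zX.
    rewrite !inE => /or3P[/eqP->|/eqP->|zA]; apply/negP; try exact: notD.
    by rewrite (disjointFr AD).
  have := gP x y xy; rewrite /f /t (negbTE (nw _ _ xd)) (negbTE (nw _ _ yd)).
  by case: (s x); case: (s y); rewrite /= ?andbF; case: (g x); case: (g y).
have eqD : g x0 (+) (s x0 && t x0) = g y0 (+) (s y0 && t y0).
  have := connect_touched (cD _ _ aB bB) (setU11 _ _).
  apply: (connect_invariant (f := fun x => g x (+) (s x && t x))).
  move=> x y /and3P[/touchedP[d xd] /touchedP[d' yd] xy].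
  have tw z d'' : comp c d'' z \in comp c a x0 |: (comp c b y0 |: D) -> s z || t z.
    move=> zX; case: (boolP (s z)) => //= sz; rewrite /t (negbTE sz) (wE _ d'') //.
    move: zX.
    by rewrite !inE => /or3P[/eqP zE|/eqP zE|//]; case/negP: sz; apply/touchedP;
      exists d''; rewrite zE.
  have := gP x y xy; have := edge x y xy; have := tw _ _ xd; have := tw _ _ yd.
  by rewrite /f; case: (s x); case: (s y); case: (t x); case: (t y);
    case: (g x); case: (g y).
move: eqD; rewrite eqA /t /s x0B y0B /= /p connect0 (negbTE y0p).
by case: (g y0).
Qed.

End Boundary.

(** * Antipodal regions and the descent *)

Lemma connect_restrict_reach (T : finType) (e : rel T) (X : {set T}) x y :
  connect (restrict e X) x y ->
  connect (restrict e [set z | connect (restrict e X) x z]) x y.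
Proof.
set C := [set z | _]; have reach p z : z \in C -> path (restrict e X) z p ->
    connect (restrict e C) z (last z p).
  elim: p z => //= z' p IH z zC /andP[zz' z'p].
  have z'C : z' \in C.
    by move: zC; rewrite !inE => /connect_trans; apply; apply: connect1.
  apply: connect_trans (IH _ z'C z'p); apply: connect1.
  by case/and3P: zz' => _ _ zz'; apply/and3P.
case/connectP=> p xp ->; apply: reach => //.
by rewrite inE.
Qed.

Section Descent.
Variables (n : nat) (c : coloring n).
Implicit Types (x y z : vertex n) (a b : color) (K L u v : mono_comp c).
Implicit Types (A D X Om : {set mono_comp c}).
Local Notation G := (@comp_graph n c).

(** The antipodes of the vertices covered by [Om] form a connected set that [Om] does not cover, so
    they lie in one connected piece of the component graph without [Om]. By maximality its boundary
    is in [Om], and it is nonempty because the component graph is connected. *)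
Lemma antipodal_region Om x0 :
  x0 \in touched Om ->
  {in touched Om &, forall x y, connect (restrict (@qadj n) (touched Om)) x y} ->
  {in touched Om, forall x, antipode x \notin touched Om} ->
  exists D, [/\ {in D &, forall K L, connect (restrict G D) K L},
    boundary D \subset Om, [disjoint D & Om], boundary D != set0 &
    {in touched Om, forall x a, comp c a (antipode x) \in D}].
Proof.
move=> x0Om cOm aOm.
have notOm x a : x \notin touched Om -> comp c a x \in ~: Om.
  by move=> xOm; rewrite inE; apply: contra xOm => aO; apply/touchedP; exists a.
pose K0 := comp c true (antipode x0).
pose D := [set K | connect (restrict G (~: Om)) K0 K].
have K0Om : K0 \in ~: Om by apply/notOm/aOm.
have DOm K : K \in D -> K \in ~: Om.
  by rewrite inE => /connect_restrict_in[<-|[]].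
have Dstep K L : K \in D -> G K L -> L \in ~: Om -> L \in D.
  move=> KD KL LOm; have KOm := DOm K KD; move: KD; rewrite !inE => KD.
  by apply: connect_trans KD _; apply: connect1; apply/and3P.
have Dsame x a b : x \notin touched Om -> comp c a x \in D -> comp c b x \in D.
  move=> xOm aD; have [<-//|ab] := eqVneq a b.
  apply: Dstep aD _ (notOm _ _ xOm).
  by have := comp_graph_negb c a x; case: a b ab => -[].
have disD : [disjoint D & Om].
  by rewrite -[Om]setCK -subsets_disjoint; apply/subsetP.
have bD : boundary D \subset Om.
  apply/subsetP => K /boundaryP[KD [L LD KL]]; apply: contraR KD => KOm.
  by apply: Dstep LD _ _; rewrite ?inE // comp_graph_sym.
exists D; split=> //.
- have csym := sym_connect_sym (restrict_sym D (@comp_graph_sym n c)).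
  move=> K L; rewrite !inE => /connect_restrict_reach KD /connect_restrict_reach LD.
  by apply: connect_trans LD; rewrite csym.
- have /touchedP[a aOm0] := x0Om.
  apply/eqP => bD0; suff /DOm: comp c a x0 \in D by rewrite inE aOm0.
  have /connectP[p] := connect_comp_graph K0 (comp c a x0).
  have : K0 \in D by rewrite inE connect0.
  elim: p (K0) => [|L p IH] K KD /=; first by move=> _ ->.
  case/andP=> KL Lp pE; apply: IH Lp pE.
  by apply/negPn/negP => /(adj_boundary KD KL); rewrite bD0 inE.
- move=> x xOm b; apply: (@Dsame _ true); first exact: aOm.
  have /connectP[p] := cOm _ _ x0Om xOm.
  have : comp c true (antipode x0) \in D by rewrite inE connect0.
  elim: p (x0) => [|y p IH] z /= zD; first by move=> _ ->.
  case/andP=> /and3P[zOm yOm zy] yp xE; apply: IH yp xE.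
  have [d dzy] : exists d, comp c d (antipode z) = comp c d (antipode y).
    by apply: qadj_comp; rewrite qadj_antipode.
  apply: (@Dsame _ d); first exact: aOm.
  by rewrite -dzy; apply: Dsame zD; apply: aOm.
Qed.

(** Each component added to [X] meets [s], hence contains a vertex already covered by [X]. *)
Lemma star_connected Om X s :
  {in touched X &, forall x y, connect (restrict (@qadj n) (touched X)) x y} ->
  s \in X -> X \subset Om -> {in Om, forall u, u \in X \/ G s u} ->
  {in touched Om &, forall x y, connect (restrict (@qadj n) (touched Om)) x y}.
Proof.
move=> cX sX XOm XG.
have csym := sym_connect_sym (restrict_sym (touched Om) (@qadj_sym n)).
have toX x : x \in touched Om -> exists2 y, y \in touched X &
    connect (restrict (@qadj n) (touched Om)) x y.
  case/touchedP=> a xOm; case: (XG _ xOm) => [xX|].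
    by exists x; [apply/touchedP; exists a | apply: connect0].
  case/comp_graphP=> b [z [sz xz]]; exists z.
    by apply/touchedP; exists b; rewrite -sz.
  by apply: connect_in_comp xOm; rewrite xz (comp_color_inj xz).
move=> x y /toX[x' x'X xx'] /toX[y' y'X yy']; apply: connect_trans xx' _.
rewrite csym; apply: connect_trans yy' _; rewrite csym.
exact: connect_restrictS (touchedS XOm) _ _ (cX _ _ x'X y'X).
Qed.

(** Induction on the size of [D]. The conditions on [A] hold for the empty set when the boundary is
    a single component, and they survive the passage from [A] to [s |: A]. *)
Lemma descent k A D : 1 < k ->
  (forall a b x p, path G (comp c a x) p ->
    last (comp c a x) p = comp c b (antipode x) -> k <= size p) ->
  {in D &, forall K L, connect (restrict G D) K L} ->
  boundary D != set0 ->
  {in touched (boundary D), forall x a, comp c a (antipode x) \in D} ->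
  [disjoint A & D] -> [disjoint A & boundary D] ->
  {in boundary D &, forall u v, connect (restrict G (u |: (v |: A))) u v} ->
  exists s : seq (mono_comp c), induced_cycle G s /\ 2 * k - 2 <= size s.
Proof.
move=> k1 far; have [m] := ubnP #|D|; elim: m A D => // m IH A D leDm.
move=> cD /set0Pn[s sB] aD AD AB cA.
have Gi := @comp_graph_irr n c; have Gs := @comp_graph_sym n c.
have trifree := @comp_graph_triangle_free n c.
have notD u : u \in boundary D -> u \notin D by case/boundaryP.
have touch u : u \in boundary D -> exists2 L, L \in D & G u L by case/boundaryP.
have cBD : {in boundary D &, forall u v, connect (restrict G (u |: (v |: D))) u v}.
  move=> u v /touch[L LD uL] /touch[M MD vM].
  have LX : L \in u |: (v |: D) by rewrite !setU1r.
  have MX : M \in u |: (v |: D) by rewrite !setU1r.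
  apply: (@connect_trans _ _ L); first by rewrite connect1_restrict ?setU11.
  apply: (@connect_trans _ _ M); last first.
    by apply: connect1_restrict MX _ _; [rewrite setU1r ?setU11 | rewrite Gs].
  by apply: connect_restrictS (cD _ _ LD MD); rewrite setUA subsetUr.
have DA K L : K \in D -> L \in A -> K != L /\ ~~ G K L.
  move=> KD LA; have LD : L \notin D by rewrite (disjointFr AD).
  split; first by apply: contraNneq LD => <-.
  by apply/negP => /(adj_boundary KD)/(_ LD); rewrite (disjointFr AB).
pose Om := boundary D :|: [set L in D | G s L].
have [sep|nosep] := boolP [exists x, (x \in touched Om) && (antipode x \in touched Om)].
  pose goal := exists s : seq (mono_comp c), induced_cycle G s /\ 2 * k - 2 <= size s.
  (* [s] is one step from [v], so its distance to [u] is at least [k - 1], and unlike [v] it lies on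
     the boundary. *)
  have mixed x a b : comp c a x \in boundary D -> comp c b (antipode x) \in D ->
      G s (comp c b (antipode x)) -> goal.
    set u := comp c a x; set v := comp c b _ => uB vD sv.
    have farv p : path G u p -> last u p = v -> k <= size p by apply: far.
    have fars p : path G u p -> last u p = s -> k <= (size p).+1.
      move=> up ps; rewrite -(size_rcons p v); apply: farv.
        by rewrite rcons_path up ps.
      by rewrite last_rcons.
    have us : u != s.
      by apply/eqP => us; have := fars [::] isT us; rewrite leqNgt k1.
    have [usG|usG] := boolP (G u s).
      have k2 : k <= 2 by apply: (fars [:: s]); rewrite //= usG.
      have /touch[L LD uL] := uB.
      have uv : u != v by apply: contraNneq (notD _ uB) => ->.
      have sX : s \notin u |: D by rewrite !inE negb_or eq_sym us notD.
      have cuv : connect (restrict G (u |: D)) u v.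
        apply: (@connect_trans _ _ L).
          by apply: connect1_restrict; rewrite ?setU11 ?setU1r.
        by apply: connect_restrictS (cD _ _ LD vD); rewrite subsetUr.
      have su : G s u by rewrite Gs.
      have [t tC] := neighbors_induced_cycle Gi Gs (trifree s) sX su sv uv cuv.
      exists t; split=> //; case: tC => t2 _ _ _; apply: leq_trans (ltnW t2).
      by rewrite leq_subLR (leq_mul2l 2 k 2).
    (* The bound 2 comes from [u] and [s] being distinct and not adjacent; it meets the requirement
       [1 < m] when [k] is 2. *)
    have [|p up ps|t [tC ts]] := @separated_induced_cycle _ _ Gi Gs A D u s
        (maxn 2 k.-1) _ _ (cBD _ _ uB sB) (cA _ _ uB sB) DA.
    - by rewrite leq_max.
    - rewrite geq_max -[k.-1]subn1 leq_subLR add1n (fars p) // andbT.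
      case: p up ps => [|w [|w' p]] //= => [_ /eqP|]; first by rewrite (negbTE us).
      by rewrite andbT => uw ws; rewrite ws (negbTE usG) in uw.
    exists t; split=> //; apply: leq_trans ts.
    by rewrite leq_subLR -[X in X + _]/(2 * 1) -mulnDr leq_mul2l -leq_subLR subn1
      leq_max leqnn orbT.
  have {sep}[x /andP[/touchedP[a xOm] /touchedP[b yOm]]] := existsP sep.
  move: xOm yOm; rewrite !in_setU !(in_set (fun L => (L \in D) && G s L)).
  case/orP=> [xB|/andP[xD sx]] /orP[yB|/andP[yD sy]].
  - have [p up pE|t [tC ts]] := @separated_induced_cycle _ _ Gi Gs A D _ _ k
      k1 _ (cBD _ _ xB yB) (cA _ _ xB yB) DA.
      exact: far pE.
    by exists t; split=> //; apply: leq_trans ts; apply: leq_subr.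
  - exact: mixed xB yD sy.
  - by apply: (mixed (antipode x) b a) => //; rewrite antipodeK.
  (* Both components are neighbours of [s], hence at distance at most 2. *)
  - have k2 : k <= 2.
      by apply: (far a b x [:: s; comp c b (antipode x)]); rewrite //= sy Gs sx.
    have xy : comp c a x != comp c b (antipode x).
      by apply/eqP => xy; have := far a b x [::] isT xy; rewrite leqNgt (ltnW k1).
    have [|t tC] := neighbors_induced_cycle Gi Gs (trifree s) _ sx sy xy (cD _ _ xD yD).
      exact: notD.
    exists t; split=> //; case: tC => t2 _ _ _; apply: leq_trans (ltnW t2).
    by rewrite leq_subLR (leq_mul2l 2 k 2).
have aOm : {in touched Om, forall x, antipode x \notin touched Om}.
  by move=> x xOm; apply: contra nosep => yOm; apply/existsP; exists x; rewrite xOm.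
have BOm : boundary D \subset Om by apply: subsetUl.
have cB := boundary_connected AD cBD cA.
have cOm : {in touched Om &, forall x y,
    connect (restrict (@qadj n) (touched Om)) x y}.
  apply: star_connected cB sB BOm _ => u.
  by rewrite !inE => /orP[->|/andP[_ ->]]; [left | right].
have [a [x0 sE]] := mono_compP s.
have x0B : x0 \in touched (boundary D) by apply/touchedP; exists a; rewrite -sE.
have x0Om := subsetP (touchedS BOm) _ x0B.
have [D' [cD' bD' D'Om bD'0 aD']] := antipodal_region x0Om cOm aOm.
have sOm : s \in Om by apply: (subsetP BOm).
(* The two regions share a component through the antipode of [x0], and a path in [D'] cannot leave
   [D] because it avoids the boundary of [D]. *)
have D'D : D' \subset D.
  apply/subsetP => K KD'; have x0D' := aD' _ x0Om true.
  have /connectP[p] := cD' _ _ x0D' KD'; have := aD _ x0B true.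
  elim: p (comp c true _) => [|L p IHp] M MD /=; first by move=> _ ->.
  case/andP=> /and3P[_ LD' ML] Lp pE; apply: IHp Lp pE.
  apply/negPn/negP => /(adj_boundary MD ML) /(subsetP BOm).
  by rewrite (disjointFr D'Om).
have ltD : #|D'| < #|D|.
  have /touch[L LD sL] := sB; apply: proper_card; apply/properP; split=> //.
  exists L => //; apply/negP => LD'.
  by have := disjointFr D'Om LD'; rewrite !inE LD sL orbT.
(* All neighbours of [s] in [D] were put into [Om], which [D'] avoids; this is what allows [s] to
   join [A]. *)
have sNB : s \notin boundary D'.
  apply/boundaryP => -[_ [L LD' sL]]; have := disjointFr D'Om LD'.
  by rewrite !inE (subsetP D'D) // sL orbT.
apply: (IH (s |: A) D') => //.
- by apply: leq_trans ltD _; rewrite -ltnS.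
- by move=> x xB b; apply: aD'; apply: (subsetP (touchedS bD')).
- rewrite disjoint_subset; apply/subsetP => K /setU1P[->|KA]; rewrite inE.
    by rewrite (disjointFl D'Om sOm).
  by apply: contraFN (disjointFr AD KA); apply: (subsetP D'D).
- rewrite disjoint_subset; apply/subsetP => K /setU1P[->//|KA]; rewrite inE.
  apply/negP => /(subsetP bD') /setUP[KB|/setIdP[KD _]].
    by rewrite (disjointFr AB KA) in KB.
  by rewrite (disjointFr AD KA) in KD.
(* Boundary components of [D'] either bound [D], and reach [s] through [A], or are neighbours of
   [s]; so [s] serves as a hub. *)
- have toS u : u \in boundary D' -> connect (restrict G (u |: (s |: A))) u s.
    move=> uB; have := subsetP bD' _ uB; rewrite !inE => /orP[uD|/andP[uD su]].
      by apply: cA => //; rewrite inE.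
    by apply: connect1_restrict; [rewrite setU11 | rewrite setU1r ?setU11 | rewrite Gs].
  move=> u v uB vB; apply: (@connect_trans _ _ s).
    by apply: connect_restrictS (toS u uB); rewrite setUS // subsetUr.
  rewrite (sym_connect_sym (restrict_sym _ Gs)).
  by apply: connect_restrictS (toS v vB); rewrite subsetUr.
Qed.

End Descent.

Theorem theorem4 (n : nat) (c : coloring n) (k : nat) :
  1 <= n -> 1 < k ->
  (forall (x : vertex n) (p : seq (vertex n)),
     path (@qadj n) x p -> uniq (x :: p) -> antipodal x (last x p) ->
     k <= color_changes c x p) ->
  exists s : seq (mono_comp c),
    induced_cycle (@comp_graph n c) s /\ 2 * k - 2 <= size s.
Proof.
move=> _ k1 /antipodal_comp_dist far.
(* The descent starts from a single red component, around an arbitrary vertex: it is connected and,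
   as [k > 0], contains no antipodal pair. The region of its antipodes then has this component as
   its whole boundary, and [A] is empty. *)
pose x0 : vertex n := [ffun=> true]; pose K0 := comp c true x0.
have inK0 x : (x \in touched [set K0]) = (comp c true x == K0).
  apply/touchedP/eqP => [[a]|xK]; last by exists true; rewrite xK inE.
  by rewrite inE => /eqP xK; have ac := comp_color_inj xK; rewrite ac in xK.
have x0in : x0 \in touched [set K0] by rewrite inK0.
have [||D [cD bD DK0 bD0 aD]] := antipodal_region x0in.
- move=> x y; rewrite !inK0 => /eqP xK /eqP yK.
  by apply: (connect_in_comp (a := true)); rewrite ?xK ?yK // inE.
- move=> x; rewrite !inK0 => /eqP xK; apply/eqP => yK.
  have := far true true x [::] isT; rewrite /= xK yK => /(_ erefl).
  by rewrite leqNgt (ltnW k1).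
have bE u : u \in boundary D -> u = K0 by move=> /(subsetP bD) /set1P.
apply: (descent (A := set0) k1 far cD bD0).
- by move=> x xB; apply: aD; apply: (subsetP (touchedS bD)).
- by apply/pred0P => K; rewrite /= inE.
- by apply/pred0P => K; rewrite /= inE.
- by move=> u v /bE-> /bE->; apply: connect0.
Qed.
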